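(* Let $L\supseteq K$ be a field extension with $[L:K]<\infty$, and let $G:=\mathrm{Aut}(L,K)$ be the group of all field automorphisms of $L$ that fix every element of $K$. Then $|G|\leq [L:K]$. If equality $|G|=[L:K]$ holds, then there is some $z\in L$ such that $L=K(z)$ and the minimal polynomial $\mu_z\in K[X]$ of $z$ over $K$ has only simple roots in $L$; furthermore, $L$ is a splitting field for $\mu_z$ over $K$.
   Context: $[L:K]$ denotes the degree of the extension, i.e. the dimension of $L$ as a $K$-vector space. $K(z)$ denotes the subfield of $L$ generated by $K$ and $z$. No assumption is made on the characteristic of the fields. Since $[L:K]<\infty$, the group $G$ is automatically finite. *)

(* Defs.v *)
From HB Require Import structures.
From mathcomp Require Import all_boot all_order all_algebra all_field.
From mathcomp Require Import boolp classical_sets functions cardinality.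

Set Implicit Arguments.
Unset Strict Implicit.
Unset Printing Implicit Defensive.

Import GRing.Theory.

Local Open Scope classical_set_scope.
Local Open Scope ring_scope.

(* The underlying set of the group Aut(L, K). The field K sits inside
   L : fieldExtType K as the set of all a%:A. The elements are plain maps
   L -> L, so it makes sense without normality or finiteness assumptions
   (unlike gal_of, which needs a splittingFieldType); K-linearity is a
   consequence, not part of the definition. *)
Definition field_Aut (K : fieldType) (L : fieldExtType K) : set (L -> L) :=
  [set f | [/\ GRing.zmod_morphism f, GRing.monoid_morphism f, bijective f
             & forall a : K, f a%:A = a%:A]].
Arguments field_Aut {K} L f : rename.

(* The multiplicity mup x p is meaningful only for p != 0, as it is for
   a minimal polynomial. *)
Definition only_simple_roots (L : fieldType) (p : {poly L}) : Prop :=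
  forall x : L, root p x -> mup x p = 1%N.

(* Main.v *)
(* By Dedekind's independence of characters, an extension L / F has at most
   [L : F] automorphisms. If |Aut(L, K)| = [L : K] and x is fixed by all of
   Aut(L, K), then this bound applied to L / K(x) forces K(x) = K. Hence every
   orbit product \prod_(y in Gx) (X - y) has coefficients in K and is the
   minimal polynomial of x, so L / K is separable and the primitive element
   theorem gives the generator z. *)
Require Import Defs.
From HB Require Import structures.
From mathcomp Require Import all_boot all_order all_algebra all_field.
From mathcomp Require Import boolp classical_sets functions cardinality.

Set Implicit Arguments.
Unset Strict Implicit.
Unset Printing Implicit Defensive.

Import GRing.Theory.

Local Open Scope classical_set_scope.
Local Open Scope ring_scope.

(* Dedekind's independence of characters. *)
Lemma monoid_morphism_free (R : pzSemiRingType) (F : idomainType)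
    (s : seq (R -> F)) (c : (R -> F) -> F) :
    uniq s -> {in s, forall f, GRing.monoid_morphism f} ->
    (forall x, \sum_(f <- s) c f * f x = 0) ->
  {in s, forall f, c f = 0}.
Proof.
elim: s c => [|f0 s IHs] c //= /andP[f0s s_uniq] morph_s c0.
have [f0_1 f0M] := morph_s f0 (mem_head _ _).
have morph_s' : {in s, forall f, GRing.monoid_morphism f}.
  by move=> f fs; apply: morph_s; rewrite inE fs orbT.
have cs : {in s, forall f, c f = 0}.
  move=> f fs; have /existsNP[y fy] : ~ (f =1 f0).
    by move=> /funext ff0; rewrite -ff0 fs in f0s.
  (* Subtract [f0 y] times the relation at [x] from the relation at [y * x]: the [f0] term cancels.
     The shorter relation, with coefficients [c g * (g y - f0 y)], falls under the induction
     hypothesis, and [f y != f0 y] forces [c f = 0]. *)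
  have /(_ f fs)/eqP : {in s, forall g, c g * (g y - f0 y) = 0}.
    apply: (IHs (fun g => c g * (g y - f0 y))) => // x.
    transitivity (\sum_(g <- f0 :: s) c g * g (y * x)
                  - f0 y * \sum_(g <- f0 :: s) c g * g x); last first.
      by rewrite !c0 mulr0 subr0.
    rewrite !big_cons mulrDr f0M [f0 y * (c f0 * _)]mulrCA opprD.
    rewrite addrACA subrr add0r mulr_sumr -sumrB big_seq [RHS]big_seq.
    apply: eq_bigr => g gs; have [_ gM] := morph_s' g gs.
    by rewrite gM mulrBr mulrBl !mulrA [f0 y * _]mulrC.
  by rewrite mulf_eq0 subr_eq0 => /orP[/eqP//|/eqP].
move=> f; rewrite inE => /predU1P[->|/cs//].
have := c0 1; rewrite big_cons f0_1 mulr1 big_seq big1 ?addr0 // => g gs.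
by rewrite cs ?mul0r.
Qed.

Lemma field_Aut_id (K : fieldType) (L : fieldExtType K) : field_Aut L id.
Proof. by split=> //; exists id. Qed.

Lemma field_Aut_linear (K : fieldType) (L : fieldExtType K) (f : L -> L) :
  field_Aut L f -> linear f.
Proof.
move=> [fB [_ fM] _ fK] a x y.
have f0 : f 0 = 0 by rewrite -[0 in LHS](subrr 0) fB subrr.
have fD u v : f (u + v) = f u + f v.
  by rewrite -[v in LHS]opprK -[- v]sub0r !fB f0 sub0r opprK.
by rewrite fD -mulr_algl fM fK mulr_algl.
Qed.

Lemma field_Aut_lrmorphism (K : fieldType) (L : fieldExtType K) (f : L -> L) :
  field_Aut L f -> exists g : {lrmorphism L -> L}, f = g.
Proof.
move=> fA; have [_ fM _ _] := fA.
pose g : {lrmorphism L -> L} :=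
  HB.pack f (GRing.isLinear.Build _ _ _ _ f (field_Aut_linear fA))
            (GRing.isMonoidMorphism.Build _ _ f fM).
by exists g.
Qed.

Lemma field_Aut_horner (K : fieldType) (L : fieldExtType K) (f : L -> L)
    (p : {poly L}) (x : L) :
  field_Aut L f -> p \is a polyOver 1%VS -> f p.[x] = p.[f x].
Proof.
move=> /field_Aut_lrmorphism[g ->] /polyOver1P[q ->].
rewrite -horner_map -map_poly_comp /=.
by congr (_.[_]); apply: eq_map_poly => a /=; rewrite linearZ rmorph1.
Qed.

(** With more automorphisms than basis vectors, the matrix of their values on a basis has a nonzero
    left kernel vector. It is a linear relation between the automorphisms on the basis, hence by
    [K]-linearity on all of [L], against independence of characters. *)
Lemma size_field_Aut (K : fieldType) (L : fieldExtType K) (s : seq (L -> L)) :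
  uniq s -> {in s, forall f, field_Aut L f} -> (size s <= \dim {:L})%N.
Proof.
move=> s_uniq sA; rewrite leqNgt; apply/negP => lt_dim_s.
pose e := vbasis {:L}.
pose A : 'M[L]_(size s, \dim {:L}) := \matrix_(i, j) nth id s i e`_j.
have : kermx A != 0.
  by rewrite kermx_eq0 -row_leq_rank -ltnNge (leq_ltn_trans _ lt_dim_s) ?rank_leq_col.
move=> /rowV0Pn[u /sub_kermxP uA /rV0Pn[i /eqP]]; apply.
(* The kernel vector is indexed by positions, but the independence lemma wants coefficients indexed
   by maps. As [s] is duplicate-free, [index] recovers the position; the default 0 only serves maps
   outside [s]. *)
pose c (f : L -> L) : L := if insub (index f s) is Some k then u 0 k else 0.
have cE (k : 'I_(size s)) : c (nth id s k) = u 0 k.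
  by rewrite /c index_uniq // valK.
have sM : {in s, forall f, GRing.monoid_morphism f} by move=> f /sA[].
rewrite -cE; apply: (monoid_morphism_free s_uniq sM); last exact: mem_nth.
move=> x; rewrite (coord_vbasis (memvf x)).
rewrite (eq_big_seq (fun f => \sum_j coord e j x *: (c f * f e`_j))); last first.
  move=> f /sA/field_Aut_lrmorphism[g ->]; rewrite linear_sum mulr_sumr.
  by apply: eq_bigr => j _; rewrite linearZ scalerAr.
rewrite exchange_big big1 //= => j _.
rewrite -scaler_sumr (big_nth id) big_mkord.
rewrite (eq_bigr (fun k => u 0 k * A k j)) => [|k _]; last by rewrite mxE cE.
by have /rowP/(_ j) := uA; rewrite !mxE => ->; rewrite scaler0.
Qed.

(** This changes the base field, so that [size_field_Aut] can be applied to [L] over an intermediate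
    field. The scalars [a%:A] of [fieldOver F] are elements of [F]. *)
Lemma field_Aut_fieldOver (K : fieldType) (L : fieldExtType K)
    (F : {subfield L}) (f : L -> L) :
    field_Aut L f -> {in F, forall x, f x = x} ->
  field_Aut (fieldOver F) f.
Proof.
move=> [fB fM fbij _] fF; split=> // a.
have aF : (a%:A : fieldOver F) \in F by rewrite -trivial_fieldOver memvZ ?mem1v.
exact: fF aF.
Qed.

Lemma fixed_field_Aut (K : fieldType) (L : fieldExtType K) (s : seq (L -> L))
    (x : L) :
    uniq s -> {in s, forall f, field_Aut L f} -> size s = \dim {:L} ->
  {in s, forall f, f x = x} -> x \in 1%VS.
Proof.
move=> s_uniq sA s_size sx; pose F := <<1; x>>%AS.
have sF : {in s, forall f, field_Aut (fieldOver F) f}.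
  move=> f fs; apply: field_Aut_fieldOver; first exact: sA.
  (* Elements of [F] are values at [x] of polynomials over [K], so a map fixing [x] fixes them
     all. *)
  move=> y /Fadjoin1_polyP[p ->].
  rewrite field_Aut_horner ?(sx f fs) //; first exact: sA.
  by apply/polyOver1P; exists p.
have := @size_field_Aut _ (fieldOver F) s s_uniq sF.
have -> : {:fieldOver F}%VS = vspaceOver F {:L}.
  by apply/vspaceP => y; rewrite (mem_aspaceOver (subvf _)) [RHS]memvf memvf.
rewrite dim_aspaceOver ?subvf // s_size => dimF.
(* Here [dimF] bounds [\dim {:L}] by its own quotient by [\dim F], which would be strictly smaller
   if [\dim F > 1]. *)
have dimF1 : \dim F = 1%N.
  apply/eqP; rewrite eqn_leq adim_gt0 andbT leqNgt; apply/negP => F_gt1.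
  by have := ltn_Pdiv F_gt1 (adim_gt0 {:L}); rewrite ltnNge dimF.
have /eqP -> : (1%VS == F :> {vspace L}).
  by rewrite eqEdim sub1v /= dimF1 dimv1.
exact: memv_adjoin.
Qed.

(** Two monic polynomials that divide each other are equal. The product is over [K] and vanishes at
    [x], so [minPoly 1 x] divides it; conversely every conjugate [f x] is a root of [minPoly 1 x],
    and [undup] makes these roots distinct. *)
Lemma minPoly_orbit (K : fieldType) (L : fieldExtType K) (s : seq (L -> L))
    (x : L) :
    uniq s -> (forall f, (f \in s) <-> field_Aut L f) -> size s = \dim {:L} ->
  minPoly 1 x = \prod_(y <- undup [seq f x | f <- s]) ('X - y%:P).
Proof.
move=> s_uniq sA s_size; set O := undup _.
have sA' : {in s, forall f, field_Aut L f} by move=> f /sA.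
have ids : id \in s by apply/sA; exact: field_Aut_id.
have s_comp f g : f \in s -> g \in s -> f \o g \in s.
  move=> /sA[fB [f1 fM] fbij fK] /sA[gB [g1 gM] gbij gK]; apply/sA; split.
  - by move=> u v /=; rewrite gB fB.
  - by split=> [|u v] /=; rewrite ?g1 ?gM.
  - exact: bij_comp.
  - by move=> a /=; rewrite gK.
have O_stable f : f \in s -> perm_eq (map f O) O.
  move=> fs; have /bij_inj f_inj : bijective f by have [] := sA' f fs.
  have fO_uniq : uniq (map f O) by rewrite map_inj_uniq ?undup_uniq.
  have fO_sub : {subset map f O <= O}.
    move=> _ /mapP[y + ->]; rewrite !mem_undup => /mapP[g gs ->]; apply/mapP.
    by exists (f \o g); first exact: s_comp.
  (* An injective map of a finite set into itself permutes it; hence [f] only reorders the factors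
     of the product and fixes its coefficients. *)
  have [|_ fO] := uniq_min_size fO_uniq fO_sub; first by rewrite size_map.
  by apply: uniq_perm => //; exact: undup_uniq.
have O_over1 : \prod_(y <- O) ('X - y%:P) \is a polyOver 1%VS.
  apply/polyOverP => i; apply: (fixed_field_Aut s_uniq sA' s_size) => f fs.
  have [g fg] := field_Aut_lrmorphism (sA' f fs).
  rewrite fg -coef_map rmorph_prod /=.
  congr (nth 0 (polyseq _) i); rewrite -[RHS](perm_big _ (O_stable f fs)) big_map.
  by apply: eq_bigr => y _; rewrite rmorphB /= map_polyX map_polyC fg.
apply/eqP; rewrite -eqp_monic ?monic_minPoly ?monic_prod_XsubC //.
apply/andP; split.
  apply: minPoly_dvdp => //; rewrite root_prod_XsubC mem_undup.
  by apply/mapP; exists id.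
apply: uniq_roots_dvdp; last by rewrite uniq_rootsE undup_uniq.
apply/allP => y; rewrite mem_undup => /mapP[f fs ->].
rewrite /root -field_Aut_horner ?minPolyOver ?minPolyxx //; last exact: sA'.
by have [g ->] := field_Aut_lrmorphism (sA' f fs); rewrite raddf0.
Qed.

Theorem corollary4 (K : fieldType) (L : fieldExtType K) :
  (field_Aut L #<= `I_(\dim {:L}))%card /\
  ((field_Aut L #= `I_(\dim {:L}))%card ->
   exists z : L,
     [/\ <<1; z>>%VS = {:L}%VS,
         only_simple_roots (minPoly 1 z)
       & splittingFieldFor 1 (minPoly 1 z) {:L}]).
Proof.
split.
  (* An infinite set would contain [(\dim {:L}).+1] distinct automorphisms, one more than
     [size_field_Aut] allows. *)
  have A_fin : finite_set (field_Aut L).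
    apply: contrapT => /(infinite_set_fset (\dim {:L}).+1)[B BA].
    by rewrite ltnNge size_field_Aut ?finmap.fset_uniq // => f; apply: BA.
  have /finite_setP[m cardA] := A_fin.
  rewrite (card_le_eql cardA) card_le_II -(card_fset_set cardA).
  rewrite size_field_Aut ?finmap.fset_uniq // => f.
  by rewrite in_fset_set // inE.
move=> cardA.
have A_fin : finite_set (field_Aut L) by apply/finite_setP; exists (\dim {:L}).
pose s : seq (L -> L) := finmap.enum_fset (fset_set (field_Aut L)).
have s_uniq : uniq s by exact: finmap.fset_uniq.
have sA f : (f \in s) <-> field_Aut L f by rewrite /s in_fset_set // inE.
have s_size : size s = \dim {:L} by exact: card_fset_set.
have minE x := minPoly_orbit x s_uniq sA s_size.
have sep : separable 1 {:L}.
  apply/separableP => x _.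
  by rewrite /separable_element minE separable_prod_XsubC undup_uniq.
pose z := separable_generator 1 {:L}; exists z.
have defL : <<1; z>>%VS = {:L}%VS.
  by rewrite -(eq_adjoin_separable_generator sep (sub1v _)).
split=> //.
  move=> x /[!minE]; rewrite root_prod_XsubC; set O := undup _ => xO.
  (* Once the factor of [x] is split off, [x] is not a root of the remaining product, since [O] has
     no duplicates. *)
  rewrite (big_rem x) //= mupMl; first by have := mup_XsubCX 1 x x; rewrite eqxx.
  by rewrite root_prod_XsubC mem_rem_uniqF ?undup_uniq.
(* The roots are the conjugates of [z]. Since [id] is in [s], they include [z] itself, so adjoining
   them already gives [L]. *)
pose rs := undup [seq f z | f <- s].
exists rs; first by rewrite minE eqpxx.
apply/eqP; rewrite eqEsubv subvf -defL; apply/(@FadjoinP _ _ _ _ <<1 & rs>>%AS).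
split; first exact: sub1v.
apply: seqv_sub_adjoin; rewrite mem_undup; apply/mapP; exists id => //.
by apply/sA; exact: field_Aut_id.
Qed.
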